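(* Let $X$ be an infinite set. Then $$\mathcal E_X = \{\alpha\in\mathcal{PB}_X : \operatorname{def}(\alpha)\leq1 \text{ and } \operatorname{sh}(\alpha)=0\} \cup \{\alpha\in\mathcal{PB}_X : \operatorname{def}(\alpha)\geq2 \text{ and } \operatorname{supp}(\alpha)<\aleph_0\} \cup \{\alpha\in\mathcal{PB}_X : \operatorname{def}(\alpha)=\operatorname{codef}(\alpha)\geq\max(\aleph_0,\operatorname{sh}(\alpha))\}.$$
   Context: Partial Brauer monoid. Let $X$ be a set and $X'=\{x':x\in X\}$ a disjoint copy of $X$. A Brauer graph is an (undirected) graph with vertex set $X\cup X'$ in which every vertex has degree at most $1$; $\mathcal{PB}_X$ is the set of all of them. Product: let $X''=\{x'':x\in X\}$ be another disjoint copy of $X$; given $\alpha,\beta\in\mathcal{PB}_X$, let $\alpha^\vee$ be $\alpha$ with each vertex $x'$ renamed $x''$, let $\beta^\wedge$ be $\beta$ with each vertex $x\in X$ renamed $x''$, and let $\Pi(\alpha,\beta)$ be the graph on $X\cup X'\cup X''$ with all edges of $\alpha^\vee$ and $\beta^\wedge$. Then $\alpha\beta$ is the graph on $X\cup X'$ with an edge $\{x,y\}$ whenever $x,y\in X\cup X'$ are distinct and lie in the same connected component of $\Pi(\alpha,\beta)$. This makes $\mathcal{PB}_X$ a monoid with identity the graph with edge set $\{\{x,x'\}:x\in X\}$. A transversal of $\alpha$ is an edge $\{x,y'\}$ with $x,y\in X$ (possibly $x=y$). $\operatorname{Dom}(\alpha)$ is the set of $x\in X$ such that $x$ belongs to a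 transversal of $\alpha$; $\operatorname{Codom}(\alpha)$ is the set of $x\in X$ such that $x'$ belongs to a transversal; $\operatorname{def}(\alpha)=|X\setminus\operatorname{Dom}(\alpha)|$ and $\operatorname{codef}(\alpha)=|X\setminus\operatorname{Codom}(\alpha)|$. For $x\in\operatorname{Dom}(\alpha)$, $x\alpha$ is the unique element with $\{x,(x\alpha)'\}$ a transversal. Let $\operatorname{Fix}(\alpha)=\{x\in\operatorname{Dom}(\alpha):x\alpha=x\}$, $\operatorname{supp}(\alpha)=|X\setminus\operatorname{Fix}(\alpha)|$ and $\operatorname{sh}(\alpha)=|\operatorname{Dom}(\alpha)\setminus\operatorname{Fix}(\alpha)|$. $\mathcal E_X$ denotes the subsemigroup of $\mathcal{PB}_X$ generated by all idempotents of $\mathcal{PB}_X$ (elements $\alpha$ with $\alpha^2=\alpha$). *)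

(* Defs.v *)
From HB Require Import structures.
From Stdlib Require Import Relations.
From mathcomp Require Import all_boot.
From mathcomp Require Import boolp classical_sets functions cardinality.

Set Implicit Arguments.
Unset Strict Implicit.
Unset Printing Implicit Defensive.

Local Open Scope classical_set_scope.
Local Open Scope card_scope.
Local Open Scope group_scope.

(* Brauer graphs on X \cup X': the vertex [inl x] is x, the vertex [inr x] is
   x'. Graphs are simple, so an edge set is a symmetric irreflexive relation;
   [pb_deg] says that every vertex has degree at most 1. *)
Record pbrauer (X : Type) := PBrauer {
  pb_edge :> X + X -> X + X -> Prop;
  pb_sym : forall u v, pb_edge u v -> pb_edge v u;
  pb_irr : forall u, ~ pb_edge u u;
  pb_deg : forall u v w, pb_edge u v -> pb_edge u w -> v = w
}.

HB.instance Definition _ X := gen_eqMixin (pbrauer X).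
HB.instance Definition _ X := gen_choiceMixin (pbrauer X).

Lemma pb_ext X (a b : pbrauer X) : (forall u v, a u v <-> b u v) -> a = b.
Proof.
case: a b => [a a1 a2 a3] [b b1 b2 b3] /= ab.
have E : a = b by apply/funext => u; apply/funext => v; apply/propext.
by subst b; congr PBrauer; apply: Prop_irrelevance.
Qed.

(* The vertex set X \cup X' \cup X'': [Up x] is x, [Mid x] is x'' and [Low x]
   is x'. *)
Inductive vertex3 (X : Type) := Up of X | Mid of X | Low of X.
Arguments Up {X}. Arguments Mid {X}. Arguments Low {X}.

Definition vee X (u : X + X) : vertex3 X :=
  match u with inl x => Up x | inr x => Mid x end.

Definition wedge X (u : X + X) : vertex3 X :=
  match u with inl x => Mid x | inr x => Low x end.

Definition outer X (u : X + X) : vertex3 X :=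
  match u with inl x => Up x | inr x => Low x end.

Definition edge_image (T U : Type) (f : T -> U) (e : T -> T -> Prop) :
    U -> U -> Prop :=
  fun p q => exists u v, [/\ e u v, f u = p & f v = q].

Definition product_graph X (a b : X + X -> X + X -> Prop) :
    vertex3 X -> vertex3 X -> Prop :=
  fun p q => edge_image (@vee X) a p q \/ edge_image (@wedge X) b p q.

Definition connected T (e : T -> T -> Prop) : T -> T -> Prop :=
  clos_refl_trans T e.

Definition pb_mul_edge X (a b : X + X -> X + X -> Prop) :
    X + X -> X + X -> Prop :=
  fun u v => u <> v /\ connected (product_graph a b) (outer u) (outer v).

Definition pb_one_edge X : X + X -> X + X -> Prop :=
  fun u v => exists x, (u = inl x /\ v = inr x) \/ (u = inr x /\ v = inl x).

Lemma connected_n1 T (e : T -> T -> Prop) u v :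
  connected e u v <-> clos_refl_trans_n1 T e u v.
Proof. exact: clos_rt_rtn1_iff. Qed.

Lemma connected_1n T (e : T -> T -> Prop) u v :
  connected e u v <-> clos_refl_trans_1n T e u v.
Proof. exact: clos_rt_rt1n_iff. Qed.

Section Connected.
Context {T : Type}.
Implicit Types (e A B P Q : T -> T -> Prop) (u v w : T).

Lemma connected_sym e : (forall u v, e u v -> e v u) ->
  forall u v, connected e u v -> connected e v u.
Proof.
move=> es u v; elim=> [x y /es|x|x y z _ yx _ zy]; first exact: rt_step.
- exact: rt_refl.
- exact: rt_trans zy yx.
Qed.

Lemma connected_sub (U : Type) (f : T -> U) e (e' : U -> U -> Prop) :
  (forall u v, e u v -> connected e' (f u) (f v)) ->
  forall u v, connected e u v -> connected e' (f u) (f v).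
Proof.
move=> ee' u v; elim=> [x y /ee' //|x|x y z _ xy _ yz]; first exact: rt_refl.
exact: rt_trans xy yz.
Qed.

Lemma connected_image (U : Type) (f : T -> U) e u q :
  connected (edge_image f e) (f u) q -> exists2 v, q = f v &
  injective f -> connected e u v.
Proof.
move=> /connected_n1; elim=> [|x y [a [b [ab <- <-]]] _ [v fv uv]].
  by exists u => // _; apply: rt_refl.
exists b => // fi; have av := fi _ _ fv; subst a.
by apply: rt_trans (uv fi) _; apply: rt_step.
Qed.

Lemma connected_range (U : Type) (f : T -> U) e p q :
  connected (edge_image f e) p q -> p <> q -> exists u, p = f u.
Proof.
move=> /connected_1n; case=> [//|x y [a [b [_ <- _]]] _ _].
by exists a.
Qed.

Lemma connected_relay (S : T -> Prop) P Q :
  (forall u v, P u v -> S u /\ S v) ->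
  forall u v, S u -> S v ->
  connected (fun p q => P p q \/ Q p q) u v <->
  connected (fun p q => P p q \/ [/\ S p, S q, p <> q & connected Q p q]) u v.
Proof.
move=> PS u v Su Sv; split; last first.
  move=> uv; apply: (connected_sub (f := id)) uv => s t [Pst|[_ _ _ st]].
    by apply: rt_step; left.
  apply: (connected_sub (f := id)) st => x y Qxy.
  by apply: rt_step; right.
pose G p q := P p q \/ [/\ S p, S q, p <> q & connected Q p q].
rewrite -/(connected G u v).
have close w x : S w -> S x -> connected G u w -> connected Q w x ->
    connected G u x.
  move=> Sw Sx uw wx; have [<-//|nwx] := pselect (w = x).
  by apply: rt_trans uw _; apply: rt_step; right.
move=> /connected_n1 uv.
suff [w [Sw uw wv]] : exists w, [/\ S w, connected G u w & connected Q w v].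
  exact: close Sw Sv uw wv.
elim: {v Sv} uv => [|x y xy _ [w [Sw uw wx]]].
  by exists u; split=> //; apply: rt_refl.
case: xy => [Pxy|Qxy].
  have [Sx Sy] := PS _ _ Pxy.
  exists y; split=> //; last exact: rt_refl.
  by apply: rt_trans (close _ _ Sw Sx uw wx) _; apply: rt_step; left.
exists w; split=> //.
by apply: rt_trans wx _; apply: rt_step.
Qed.

Lemma connected_deg e : (forall u v, e u v -> e v u) ->
  (forall u v w, e u v -> e u w -> v = w) ->
  forall u v, connected e u v -> u = v \/ e u v.
Proof.
move=> es ed u v /connected_n1; elim=> [|x y xy _ [->|ux]]; [by left|by right|].
by left; apply: ed (es _ _ ux) xy.
Qed.

(* A walk alternating between A-edges and B-edges; the boolean records whether
   the last edge was an A-edge. *)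
Definition alternating_step A B (s t : T * bool) : Prop :=
  t.2 = ~~ s.2 /\ (if s.2 then B s.1 t.1 else A s.1 t.1).

Lemma alternating_end_aux A B u v w :
  (forall u v, A u v -> A v u) -> (forall u v, B u v -> B v u) ->
  (forall u v w, A u v -> A u w -> v = w) ->
  (forall u v w, B u v -> B u w -> v = w) ->
  (forall z, z = v \/ z = w -> forall x y, A z x -> B z y -> False) ->
  (forall x, ~ B u x) ->
  connected (fun p q => A p q \/ B p q) u v ->
  connected (fun p q => A p q \/ B p q) u w ->
  u <> v -> u <> w -> v = w.
Proof.
move=> As Bs Ad Bd ov nB.
pose R := clos_refl_trans_1n _ (alternating_step A B) (u, false).
have Rinv s : R s -> s = (u, false) \/ exists2 t, R t & alternating_step A B t s.
  move=> /connected_1n/connected_n1; case=> [|t r tr ut]; [by left|right].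
  by exists t => //; apply/connected_1n/connected_n1.
have Rstep s t : R s -> alternating_step A B s t -> R t.
  move=> Rs st; apply/connected_1n; apply: rt_trans ((connected_1n _ _ _).2 Rs) _.
  exact: rt_step.
have reach x : connected (fun p q => A p q \/ B p q) u x ->
    exists b, R (x, b).
  move=> /connected_n1; elim=> [|y z yz _ [b Ry]].
    by exists false; apply: rt1n_refl.
  case: b Ry => Ry; case: yz => yz.
  - have [//|[[t b] Rt [/= ]]] := Rinv _ Ry; case: b Rt => // Rt _ ty.
    by exists false; rewrite (Ad _ _ _ yz (As _ _ ty)).
  - by exists false; apply: Rstep Ry _; split.
  - by exists true; apply: Rstep Ry _; split.
  - have [[yu]|[[t b] Rt [/= ]]] := Rinv _ Ry.
      by case: (nB z); rewrite -yu.
    case: b Rt => // Rt _ ty.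
    by exists true; rewrite (Bd _ _ _ yz (Bs _ _ ty)).
have stepd s t r : alternating_step A B s t -> alternating_step A B s r -> t = r.
  case: s t r => [s b] [t c] [r d] [/= -> st] [/= -> sr].
  by case: b st sr => st sr; [rewrite (Bd _ _ _ st sr)|rewrite (Ad _ _ _ st sr)].
have nf x b : x = v \/ x = w -> u <> x -> R (x, b) ->
    forall t, ~ alternating_step A B (x, b) t.
  move=> xvw ux Rx [t c] [/= _ xt].
  have [[xu _]|[[y d] _ [/= bd yx]]] := Rinv _ Rx; first by case: ux.
  case: d bd yx => bd yx; subst b.
    exact: (ov x xvw t y xt (Bs _ _ yx)).
  exact: (ov x xvw y t (As _ _ yx) xt).
move=> /reach[b Rv] /reach[c Rw] uv uw.
have nfv := nf v b (or_introl erefl) uv Rv.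
have nfw := nf w c (or_intror erefl) uw Rw.
suff : (v, b) = (w, c) by case.
move: Rv Rw nfv nfw; rewrite /R; move: (u, false) (v, b) (w, c) => s t r.
move=> {R Rinv Rstep reach nf} st sr nt nr.
elim: st sr nt => [s' sr nt|s' t' t'' st _ IH sr nt].
  by case: sr nt nr => [//|s1 s2 s12 _ /(_ s1)].
case: sr nr IH => [nr|s1 s2 s12 s1r nr IH]; first by case: (nr t').
by apply: IH => //; rewrite (stepd _ _ _ st s12).
Qed.

Lemma alternating_end A B u v w :
  (forall u v, A u v -> A v u) -> (forall u v, B u v -> B v u) ->
  (forall u v w, A u v -> A u w -> v = w) ->
  (forall u v w, B u v -> B u w -> v = w) ->
  (forall z, z = u \/ z = v \/ z = w -> forall x y, A z x -> B z y -> False) ->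
  connected (fun p q => A p q \/ B p q) u v ->
  connected (fun p q => A p q \/ B p q) u w ->
  u <> v -> u <> w -> v = w.
Proof.
move=> As Bs Ad Bd ou.
have [[x Aux]|nA] := pselect (exists x, A u x).
  apply: alternating_end_aux => // [z zvw|y]; first by apply: ou; right.
  by apply: ou Aux; left.
have comm p q : connected (fun p q => A p q \/ B p q) p q ->
    connected (fun p q => B p q \/ A p q) p q.
  apply: (connected_sub (f := id)) => x y xy; apply: rt_step.
  by case: xy; [right|left].
move=> /comm uv /comm uw; apply: (alternating_end_aux _ _ _ _ _ _ uv uw) => //.
- by move=> z zvw x y Bz Az; apply: (ou z _ y x Az Bz); right.
- by move=> x Aux; apply: nA; exists x.
Qed.
End Connected.

Section ImageLemmas.
Context {T U : Type} (f : T -> U).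
Hypothesis fi : injective f.
Implicit Types e : T -> T -> Prop.

Lemma edge_image_sym e : (forall u v, e u v -> e v u) ->
  forall p q, edge_image f e p q -> edge_image f e q p.
Proof. by move=> es p q [u [v [uv <- <-]]]; exists v, u; split=> //; apply: es. Qed.

Lemma edge_image_deg e : (forall u v w, e u v -> e u w -> v = w) ->
  forall p q r, edge_image f e p q -> edge_image f e p r -> q = r.
Proof.
move=> ed p q r [u [v [uv <- <-]]] [u' [w [u'w /fi uu' <-]]].
by subst u'; rewrite (ed _ _ _ uv u'w).
Qed.

Lemma connected_imageE e u v :
  connected (edge_image f e) (f u) (f v) <-> connected e u v.
Proof.
split=> [uv|]; first by have [w /fi -> ] := connected_image uv; apply.
by apply: connected_sub => x y xy; apply: rt_step; exists x, y.
Qed.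
End ImageLemmas.

Lemma edge_image_comp T U V (f : T -> U) (g : U -> V) e p q :
  edge_image g (edge_image f e) p q <-> edge_image (g \o f) e p q.
Proof.
split=> [[_ [_ [[u [v [uv <- <-]]] <- <-]]]|[u [v [uv <- <-]]]].
  by exists u, v.
by exists (f u), (f v); split=> //; exists u, v.
Qed.

Section Product.
Context {X : Type}.
Implicit Types (a b c : pbrauer X) (u v w : X + X).

Lemma vee_inj : injective (@vee X).
Proof. by move=> [x|x] [y|y] //= [->]. Qed.

Lemma wedge_inj : injective (@wedge X).
Proof. by move=> [x|x] [y|y] //= [->]. Qed.

Lemma outer_inj : injective (@outer X).
Proof. by move=> [x|x] [y|y] //= [->]. Qed.

Lemma product_graph_sym a b p q :
  product_graph a b p q -> product_graph a b q p.
Proof.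
by case=> ab; [left|right]; apply: edge_image_sym ab; apply: pb_sym.
Qed.

Lemma pb_mul_sym a b u v : pb_mul_edge a b u v -> pb_mul_edge a b v u.
Proof.
move=> [uv cuv]; split; first by move=> vu; apply: uv.
by apply: connected_sym cuv => p q; apply: product_graph_sym.
Qed.

Lemma pb_mul_irr a b u : ~ pb_mul_edge a b u u.
Proof. by case. Qed.

Lemma pb_mul_deg a b u v w :
  pb_mul_edge a b u v -> pb_mul_edge a b u w -> v = w.
Proof.
move=> [nuv uv] [nuw uw]; apply: outer_inj.
apply: (alternating_end _ _ _ _ _ uv uw).
- exact: edge_image_sym (@pb_sym _ _).
- exact: edge_image_sym (@pb_sym _ _).
- by apply: (edge_image_deg vee_inj); apply: pb_deg.
- by apply: (edge_image_deg wedge_inj); apply: pb_deg.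
- have H z x y : edge_image (@vee X) a (outer z) x ->
      edge_image (@wedge X) b (outer z) y -> False.
    by case: z => z [[?|?] [? [_ //= ? _]]] [[?|?] [? [_ //= ? _]]].
  by move=> z [->|[->|->]] x y; apply: H.
- by move/outer_inj.
- by move/outer_inj.
Qed.

Definition pb_mul a b : pbrauer X :=
  PBrauer (@pb_mul_sym a b) (@pb_mul_irr a b) (@pb_mul_deg a b).

Lemma pb_one_sym u v : pb_one_edge u v -> pb_one_edge v u.
Proof. by move=> [x [[-> ->]|[-> ->]]]; exists x; [right|left]. Qed.

Lemma pb_one_irr u : ~ @pb_one_edge X u u.
Proof. by move=> [x [[-> //]|[-> //]]]. Qed.

Lemma pb_one_deg u v w : pb_one_edge u v -> pb_one_edge u w -> v = w.
Proof.
by move=> [x [[-> ->]|[-> ->]]] [y [[// [->] ->]|[// [->] ->]]].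
Qed.

Definition pb_one : pbrauer X := PBrauer pb_one_sym pb_one_irr pb_one_deg.

Lemma pb_mul1 : left_id pb_one pb_mul.
Proof.
move=> a; apply: pb_ext => u v; split=> [[nuv uv]|auv].
  pose r (p : vertex3 X) := match p with Up x | Mid x => inl x | Low x => inr x end.
  have rK w : r (outer w) = w by case: w.
  have : connected a (r (outer u)) (r (outer v)).
    apply: connected_sub uv => _ _ [[s [t [st <- <-]]]|[s [t [st <- <-]]]].
      by case: st => x [[-> ->]|[-> ->]] /=; apply: rt_refl.
    by apply: rt_step; case: s t st => [s|s] [t|t].
  rewrite !rK => /(connected_deg (@pb_sym _ a) (@pb_deg _ a))[/nuv//|//].
split; first by move=> uv; subst v; apply: pb_irr auv.
have ow w : connected (product_graph pb_one a) (outer w) (wedge w).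
  case: w => x; last exact: rt_refl.
  by apply: rt_step; left; exists (inl x), (inr x); split=> //; exists x; left.
apply: rt_trans (ow u) _; apply: rt_trans; last first.
  by apply: connected_sym (ow v) => p q; apply: product_graph_sym.
by apply: rt_step; right; exists u, v.
Qed.

Lemma pb_mulr1 : right_id pb_one pb_mul.
Proof.
move=> a; apply: pb_ext => u v; split=> [[nuv uv]|auv].
  pose r (p : vertex3 X) := match p with Up x => inl x | Mid x | Low x => inr x end.
  have rK w : r (outer w) = w by case: w.
  have : connected a (r (outer u)) (r (outer v)).
    apply: connected_sub uv => _ _ [[s [t [st <- <-]]]|[s [t [st <- <-]]]].
      by apply: rt_step; case: s t st => [s|s] [t|t].
    by case: st => x [[-> ->]|[-> ->]] /=; apply: rt_refl.
  rewrite !rK => /(connected_deg (@pb_sym _ a) (@pb_deg _ a))[/nuv//|//].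
split; first by move=> uv; subst v; apply: pb_irr auv.
have ow w : connected (product_graph a pb_one) (outer w) (vee w).
  case: w => x; first exact: rt_refl.
  by apply: rt_step; right; exists (inr x), (inl x); split=> //; exists x; right.
apply: rt_trans (ow u) _; apply: rt_trans; last first.
  by apply: connected_sym (ow v) => p q; apply: product_graph_sym.
by apply: rt_step; left; exists u, v.
Qed.

(* Associativity: both bracketings of a * b * c are computed by the four-layer
   graph whose layers 0-1, 1-2 and 2-3 carry a, b and c. *)
Definition layer (i j : nat) (u : X + X) : nat * X :=
  match u with inl x => (i, x) | inr x => (j, x) end.

Definition embed (i j k : nat) (p : vertex3 X) : nat * X :=
  match p with Up x => (i, x) | Mid x => (j, x) | Low x => (k, x) end.

Definition layers3 a b c (p q : nat * X) : Prop :=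
  [\/ edge_image (layer 0 1) a p q, edge_image (layer 1 2) b p q |
      edge_image (layer 2 3) c p q].

Lemma connected_eq T (e e' : T -> T -> Prop) p q :
  (forall p q, e p q <-> e' p q) -> connected e p q <-> connected e' p q.
Proof.
move=> ee; split; apply: (connected_sub (f := id)) => x y xy;
  by apply: rt_step; apply/ee.
Qed.

Lemma embed_inj i j k : i != j -> i != k -> j != k -> injective (embed i j k).
Proof.
move=> /eqP ij /eqP ik /eqP jk [x|x|x] [y|y|y] //= [] //; try by move=> ->.
all: by move=> E; exfalso; move: (ij) (ik) (jk); rewrite E.
Qed.

Lemma embed_product i j k a b p q :
  edge_image (embed i j k) (product_graph a b) p q <->
  edge_image (layer i j) a p q \/ edge_image (layer j k) b p q.
Proof.
split=> [[_ [_ [[|] [u [v [uv <- <-]]] <- <-]]]|[|] [u [v [uv <- <-]]]].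
- by left; exists u, v; split=> //; case: (u) (v) => [?|?] [?|?].
- by right; exists u, v; split=> //; case: (u) (v) => [?|?] [?|?].
- exists (vee u), (vee v); split; [|by case: (u)|by case: (v)].
  by left; exists u, v.
- exists (wedge u), (wedge v); split; [|by case: (u)|by case: (v)].
  by right; exists u, v.
Qed.

(* The relation substituted for Q in [connected_relay], when Q is the image of
   a product graph, is the image of the product. *)
Lemma relay_product (S : nat * X -> Prop) i j k a b p q :
    i != j -> i != k -> j != k ->
    (forall x, S (embed i j k x) <-> exists u, x = outer u) ->
  [/\ S p, S q, p <> q & connected (edge_image (embed i j k) (product_graph a b)) p q]
  <-> edge_image (layer i k) (pb_mul a b) p q.
Proof.
move=> ij ik jk SE; have ei := embed_inj ij ik jk.
have oe u : embed i j k (outer u) = layer i k u by case: u.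
split=> [[Sp Sq npq pq]|[u [v [[nuv uv] <- <-]]]].
  have [x px] := connected_range pq npq; subst p.
  have [y qy _] := connected_image pq; subst q.
  have [u xu] := (SE _).1 Sp; have [v yv] := (SE _).1 Sq; subst x y.
  exists u, v; split=> //; split; first by move=> uv; apply: npq; rewrite uv.
  exact/(connected_imageE ei).
rewrite -!oe; split; [by apply/SE; exists u|by apply/SE; exists v| |].
  by move=> /ei/outer_inj.
exact/(connected_imageE ei).
Qed.

Lemma pb_mulA : associative pb_mul.
Proof.
move=> a b c; apply: pb_ext => u v.
suff [L R] : (connected (layers3 a b c) (layer 0 3 u) (layer 0 3 v) <->
      connected (product_graph a (pb_mul b c)) (outer u) (outer v)) /\
    (connected (layers3 a b c) (layer 0 3 u) (layer 0 3 v) <->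
      connected (product_graph (pb_mul a b) c) (outer u) (outer v)).
  by split=> -[nuv uv]; split=> //; [apply/R/L|apply/L/R].
split.
- have ei : injective (embed 0 1 3) by apply: embed_inj.
  have oe w : layer 0 3 w = embed 0 1 3 (outer w) by case: w.
  rewrite !oe -(connected_imageE ei).
  pose S (p : nat * X) := p.1 != 2%N.
  transitivity (connected (fun p q => edge_image (layer 0 1) a p q \/
      edge_image (embed 1 2 3) (product_graph b c) p q)
      (embed 0 1 3 (outer u)) (embed 0 1 3 (outer v))).
    apply: connected_eq => p q; rewrite embed_product /layers3.
    by split=> [[]|[|[]]]; by [constructor 1|constructor 2|constructor 3|left|right; left|right; right].
  rewrite (connected_relay (S := S)); first last.
  + by case: (v).
  + by case: (u).
  + by move=> _ _ [[s|s] [[t|t] [_ <- <-]]].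
  apply: connected_eq => p q; rewrite embed_product.
  cbv beta; rewrite (relay_product (S := S)) // => -[x|x|x]; split=> //.
  + by exists (inl x).
  + by case=> -[].
  + by exists (inr x).
- have ei : injective (embed 0 2 3) by apply: embed_inj.
  have oe w : layer 0 3 w = embed 0 2 3 (outer w) by case: w.
  rewrite !oe -(connected_imageE ei).
  pose S (p : nat * X) := p.1 != 1%N.
  transitivity (connected (fun p q => edge_image (layer 2 3) c p q \/
      edge_image (embed 0 1 2) (product_graph a b) p q)
      (embed 0 2 3 (outer u)) (embed 0 2 3 (outer v))).
    apply: connected_eq => p q; rewrite embed_product /layers3.
    by split=> [[]|[|[]]]; by [constructor 1|constructor 2|constructor 3|left|right; left|right; right].
  rewrite (connected_relay (S := S)); first last.
  + by case: (v).
  + by case: (u).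
  + by move=> _ _ [[s|s] [[t|t] [_ <- <-]]].
  apply: connected_eq => p q; rewrite embed_product or_comm.
  cbv beta; rewrite (relay_product (S := S)) // => -[x|x|x]; split=> //.
  + by exists (inl x).
  + by case=> -[].
  + by exists (inr x).
Qed.
End Product.

HB.instance Definition _ X :=
  isMonoid.Build (pbrauer X) (@pb_mulA X) (@pb_mul1 X) (@pb_mulr1 X).

Section PartialMap.
Context {X : Type}.
Implicit Types a : pbrauer X.

Definition transversal a (x y : X) : Prop := a (inl x) (inr y).

Definition Dom a : set X := [set x | exists y, transversal a x y].

Definition Codom a : set X := [set y | exists x, transversal a x y].

(* x alpha, for x in Dom alpha *)
Definition pb_app a (x : X) (ax : Dom a x) : X := sval (cid ax).

Lemma pb_appP a x y (ax : Dom a x) : pb_app ax = y <-> transversal a x y.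
Proof.
rewrite /pb_app; case: cid => z /= xz; split=> [<- //|xy].
by have [] := pb_deg xz xy.
Qed.

Definition Fix a : set X := [set x | exists ax : Dom a x, pb_app ax = x].

Lemma FixE a x : Fix a x <-> transversal a x x.
Proof.
split=> [[ax /pb_appP //]|axx].
by exists (ex_intro _ x axx); apply/pb_appP.
Qed.

(* The cardinal parameters are represented by sets of that cardinality, to be
   compared by means of [#<=] and [#=]. *)
Definition def a : set X := ~` Dom a.
Definition codef a : set X := ~` Codom a.
Definition supp a : set X := ~` Fix a.
Definition sh a : set X := Dom a `\` Fix a.
End PartialMap.

Definition idempotents (M : monoidType) : set M := [set a | a * a = a].

Definition subsemigroup_gen (M : monoidType) (G : set M) : set M :=
  smallest [set S : set M | mulg_closed (mem S)] G.

Definition E_ X : set (pbrauer X) :=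
  subsemigroup_gen (@idempotents (pbrauer X)).
Arguments E_ : clear implicits.

(* Main.v *)
From Stdlib Require Import Relations.
From mathcomp Require Import all_boot.
From mathcomp Require Import boolp classical_sets functions cardinality.
Require Import Defs.

(** Necessity. If an idempotent a maps x to y and y <> x, then the path that
    starts at x in the product graph of a with itself can only come back to y'
    through an upper hook at y; dually x' lies on a lower hook. So the points
    moved by a inject into the upper defect and into the lower defect. Hence
    an idempotent with infinite support has defect and codefect of the size of
    its support, and one with defect at most 1 moves nothing. Both facts
    ([good]) pass to products ([good_mul]). The defect and codefect of a * b
    are bounded below by the defect of a and the codefect of b. Suppose that b
    has the larger support, of infinite size k. Then a point that is undefined
    for b becomes defined for a * b only if it, or its partner in an upper hook
    of b, lies in the support of a. So either the defect of a * b has size k,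
    or the support of a has size k, and then so does the defect of a. The case
    where a has the larger support follows by the reflection [flip]. When the
    supports are finite and a * b has defect at most 1, a is a partial
    identity, which forces the same for b. Finally [good] is a rephrasing of
    the three-part description ([goodP]).

    Sufficiency. If the transversals of g include those of a, then a is e g f,
    where e carries the upper hooks of a and the identity on Dom a, and f
    carries the lower hooks of a and the identity on Codom a ([sandwich]); both
    e and f are idempotent. So only the partial bijection x |-> x a has to be
    realized inside a product of idempotents. The building block is the
    idempotent [slide]: upper hook {t, z}, lower hook {s', z'}, transversal
    {s, t'}, which moves a token from s to a free place t with the help of a
    second free place z, and does so for many disjoint triples (s, t, z) at
    once.
    - Finite support, two free places: every slide of a token into its target
      decreases the number of misplaced tokens, and an occupied target can
      first be vacated into a free place ([realizable_finite]).
    - Infinite defect of size at least the shift: three slides are enough. All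
      the moved tokens go into the upper defect, from there into a disjoint
      part of the lower defect, and from there to their targets, which the
      lower defect does not meet. [disjoint_copies] provides enough room.

    The cardinal arithmetic rests on A * nat <= A for infinite A
    ([infinite_setX_nat]) and on the comparability of cardinals
    ([card_le_total]), both by Zorn's lemma. *)

Set Implicit Arguments.
Unset Strict Implicit.
Unset Printing Implicit Defensive.

Local Open Scope classical_set_scope.
Local Open Scope card_scope.
Local Open Scope group_scope.

(** * Cardinals *)

(** Comparing cardinals through injective relations saves choosing a function,
    and the target type may be empty. *)
Lemma card_le_rel T U (A : set T) (B : set U) (R : T -> U -> Prop) :
  (forall x, A x -> exists2 y, B y & R x y) ->
  (forall x x' y, A x -> A x' -> R x y -> R x' y -> x = x') ->
  A #<= B.
Proof.
move=> tot inj; apply/card_leP/injfunPex.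
have H (a : A) : exists b : B, R (val a) (val b).
  have [y By Ray] := tot _ (set_mem (valP a)).
  by exists (SigSub (mem_set By)).
exists (fun a => sval (cid (H a))) => // a a' _ _ /= E.
move: (svalP (cid (H a))) (svalP (cid (H a'))); rewrite E => h1 h2.
apply: val_inj; apply: inj h1 h2; exact: set_mem (valP _).
Qed.

Lemma card_le_fun T U (A : set T) (B : set U) : A #<= B ->
  U -> exists2 f : T -> U, (forall x, A x -> B (f x)) &
  (forall x x', A x -> A x' -> f x = f x' -> x = x').
Proof.
move=> /card_leP/injfunPex[f _ fi] u0.
pose g x :=
  if pselect (A x) is left Ax then val (f (SigSub (mem_set Ax))) else u0.
exists g => [x Ax|x x' Ax Ax']; rewrite /g.
  by case: pselect => // Ax'; apply: set_mem (valP _).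
case: pselect => // {}Ax; case: pselect => // {}Ax' /val_inj E.
have := fi _ _ _ _ E; rewrite !inE => /(_ I I).
by move=> /(congr1 val).
Qed.

(** A maximal family F of injections nat -> A with disjoint ranges covers all
    but finitely many points of A, so A injects into F * nat, and nat * nat
    injects into nat. *)
Lemma infinite_setX_nat T (A : set T) : infinite_set A ->
  A `*` [set: nat] #<= A.
Proof.
move=> Ainf.
have [a0 Aa0] := infinite_setN0 Ainf.
pose P (F : set (nat -> T)) := (forall f n, F f -> A (f n)) /\
  (forall f g n m, F f -> F g -> f n = g m -> f = g /\ n = m).
have [F [[FA Finj] Fmax]] : exists F, P F /\ forall G, F `<` G -> ~ P G.
  apply: Zorn_bigcup => C CP Ctot; split=> [f n [F CF Ff]|].
    exact: (CP _ CF).1 Ff.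
  move=> f g n m [F CF Ff] [G CG Gg].
  have [FG|GF] := Ctot _ _ CF CG.
    by apply: (CP _ CG).2 => //; apply: FG.
  by apply: (CP _ CF).2 => //; apply: GF.
pose B : set T := [set x | exists f n, F f /\ x = f n].
have ABfin : finite_set (A `\` B).
  apply: contrapT => /infiniteP/card_le_fun/(_ a0)[g gAB ginj].
  have nFg : ~ F g by move=> Fg; apply: (gAB 0%N I).2; exists g, 0%N.
  apply: (Fmax (F `|` [set g])).
    by split=> [f Ff|/(_ g (or_intror erefl))]; [left|].
  split=> [f n [/FA //|->]|f h n m]; first exact: (gAB n I).1.
  move=> [Ff|->] [Fh|->] E; first exact: Finj.
  - by case: (gAB m I).2; exists f, n.
  - by case: (gAB n I).2; exists h, m.
  - by split=> //; apply: ginj.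
have [f0 Ff0] : exists f, F f.
  apply: contrapT => nF; apply: Ainf; apply: sub_finite_set ABfin => x Ax.
  by split=> // -[f [n [Ff _]]]; apply: nF; exists f.
have [c _ cinj] := card_le_fun (finite_set_countable ABfin) 0%N.
(* Even indices encode the covered points; the finitely many others are put at
   odd indices of the chosen sequence f0. *)
pose code x (f : nat -> T) n :=
  (exists2 m, x = f m & n = m.*2) \/ [/\ f = f0, (A `\` B) x & n = (c x).*2.+1].
apply: (card_le_rel (R := fun p y => exists f n,
   [/\ F f, code p.1 f n & y = f (pickle (n, p.2))])).
  move=> [x k] /= [Ax _].
  have [[f [n [Ff ->]]]|nBx] := pselect (B x).
    exists (f (pickle (n.*2, k))); first exact: FA.
    by exists f, n.*2; split=> //; left; exists n.
  exists (f0 (pickle ((c x).*2.+1, k))); first exact: FA.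
  by exists f0, (c x).*2.+1; split=> //; right.
move=> [x k] [x' k'] y /= [Ax _] [Ax' _] [f [n [Ff xfn ->]]].
move=> [f' [n' [Ff' xfn' E]]].
have {E} [ff' /(pcan_inj (@pickleK _))[nn' ->]] := Finj _ _ _ _ Ff Ff' E.
subst f' n'; congr pair.
move: xfn xfn' => [[m -> nE]|[_ ABx nE]] [[m' ->]|[_ ABx']]; rewrite {}nE => E.
- by move/double_inj: E => ->.
- by move/(congr1 odd): E; rewrite /= !odd_double.
- by move/(congr1 odd): E; rewrite /= !odd_double.
- by apply: cinj => //; apply: double_inj; case: E.
Qed.

Lemma card_le_setU T U (A : set T) (B C : set U) : infinite_set A ->
  B #<= A -> C #<= A -> B `|` C #<= A.
Proof.
move=> Ainf BA CA; have [a0 _] := infinite_setN0 Ainf.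
have [f fA fi] := card_le_fun BA a0.
have [g gA gi] := card_le_fun CA a0.
apply: card_le_trans (infinite_setX_nat Ainf).
apply: (card_le_rel (R := fun x p =>
  (B x /\ p = (f x, 0%N)) \/ (C x /\ p = (g x, 1%N)))).
  by move=> x [Bx|Cx]; [exists (f x, 0%N)|exists (g x, 1%N)];
    rewrite /=; auto.
move=> x x' y _ _ [[Bx ->]|[Cx ->]] [[Bx' []]|[Cx' []]] //.
  exact: fi.
exact: gi.
Qed.

(** A maximal partial injection between A and B exhausts A or B. *)
Lemma card_le_total T U (A : set T) (B : set U) : A #<= B \/ B #<= A.
Proof.
pose P (G : set (T * U)) :=
  [/\ G `<=` A `*` B, (forall x y y', G (x, y) -> G (x, y') -> y = y') &
      (forall x x' y, G (x, y) -> G (x', y) -> x = x')].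
have [G [[GAB Gf Gi] Gmax]] : exists G, P G /\ forall H, G `<` H -> ~ P H.
  apply: Zorn_bigcup => C CP Ctot.
  have two p q : (\bigcup_(G in C) G) p -> (\bigcup_(G in C) G) q ->
      exists G, [/\ C G, G p & G q].
    move=> [G CG Gp] [H CH Hq].
    have [GH|HG] := Ctot _ _ CG CH; [exists H|exists G]; split=> //.
      exact: GH.
    exact: HG.
  split=> [p [G CG Gp]|x y y' xy xy'|x x' y xy xy'].
  - by have [h _ _] := CP _ CG; apply: h.
  - have [G [CG h1 h2]] := two _ _ xy xy'.
    by have [_ h _] := CP _ CG; apply: h h1 h2.
  - have [G [CG h1 h2]] := two _ _ xy xy'.
    by have [_ _ h] := CP _ CG; apply: h h1 h2.
have [Atot|/existsNP[a]] := pselect (forall x, A x -> exists y, G (x, y)).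
  left; apply: (card_le_rel (R := fun x y => G (x, y))) => [x /Atot[y Gxy]|].
    by exists y => //; case: (GAB _ Gxy).
  by move=> x x' y _ _; apply: Gi.
move=> /not_implyP[Aa Ga].
right; apply: (card_le_rel (R := fun y x => G (x, y))) => [b Bb|]; last first.
  by move=> y y' x _ _; apply: Gf.
apply: contrapT => Gb.
have {}Gb x : ~ G (x, b).
  by move=> Gxb; apply: Gb; exists x => //; case: (GAB _ Gxb).
have {}Ga y : ~ G (a, y) by move=> Gay; apply: Ga; exists y.
apply: (Gmax (G `|` [set (a, b)])).
  by split=> [p Gp|/(_ (a, b) (or_intror erefl))/Ga]; [left|].
split.
- by move=> p [/GAB//|->].
- move=> x y y' [h|[-> ->]] [h'|[]]; try by move=> *; subst; case: (Ga y).
  + exact: Gf h h'.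
  + by case: (Ga y').
  + by move=> ->.
- move=> x x' y [h|[-> ->]] [h'|[]]; try by move=> *; subst; case: (Gb x).
  + exact: Gi h h'.
  + by case: (Gb x').
  + by move=> ->.
Qed.

Lemma infinite_card_leU T U (A : set T) (B C : set U) : infinite_set A ->
  A #<= B `|` C -> A #<= B \/ A #<= C.
Proof.
move=> Ainf ABC.
have BC0 : infinite_set (B `|` C).
  by move=> fBC; apply: Ainf; apply: card_le_finite fBC.
have [BC|CB] := card_le_total B C.
- right; apply: card_le_trans ABC _; apply: card_le_setU => // Cfin.
  by apply: BC0; rewrite finite_setU; split=> //; apply: card_le_finite Cfin.
- left; apply: card_le_trans ABC _; apply: card_le_setU => // Bfin.
  by apply: BC0; rewrite finite_setU; split=> //; apply: card_le_finite Bfin.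
Qed.

(** A contains two disjoint copies of itself, told apart by the parity of an
    index. If C is the even one, then B `&` C or B `\` C is as large as A; it
    receives q, and p goes to the copy that avoids it. *)
Lemma disjoint_copies T (A B : set T) : infinite_set A -> A #<= B ->
  exists p q : T -> nat -> T,
  [/\ forall x n, A x -> A (p x n) /\ B (q x n),
      forall x y n m, A x -> A y -> p x n = p y m -> x = y /\ n = m,
      forall x y n m, A x -> A y -> q x n = q y m -> x = y /\ n = m &
      forall x y n m, A x -> A y -> p x n <> q y m].
Proof.
move=> Ainf AB; have [a0 _] := infinite_setN0 Ainf.
have [f fA fi] := card_le_fun (infinite_setX_nat Ainf) a0.
have {}fi x y n m : A x -> A y -> f (x, n) = f (y, m) -> x = y /\ n = m.
  by move=> Ax Ay E; case: (fi (x, n) (y, m) (conj Ax I) (conj Ay I) E).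
have {}fA x n : A x -> A (f (x, n)) by move=> Ax; apply: fA.
pose C := [set f (x, n.*2) | x in A & n in [set: nat]].
have key D : D `<=` B -> A #<= D -> exists q : T -> nat -> T,
    (forall x n, A x -> D (q x n)) /\
    (forall x y n m, A x -> A y -> q x n = q y m -> x = y /\ n = m).
  move=> DB AD; have [g gD gi] := card_le_fun AD a0.
  exists (fun x n => g (f (x, n))); split=> [x n Ax|x y n m Ax Ay].
    by apply: gD; apply: fA.
  by move/(gi _ _ (fA _ _ Ax) (fA _ _ Ay)); apply: fi.
have : A #<= (B `&` C) `|` (B `\` C) by rewrite setUIDK.
move=> /(infinite_card_leU Ainf)[|] /key[|q [qD qi]].
- by move=> x [].
- exists (fun x n => f (x, n.*2.+1)), q; split=> [x n Ax|||] //.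
  + by split; [apply: fA|have [] := qD x n Ax].
  + by move=> x y n m Ax Ay /(fi _ _ _ _ Ax Ay)[-> []/double_inj].
  + move=> x y n m Ax Ay E; have [_ [z Az [k _]]] := qD y m Ay.
    rewrite -E => /(fi _ _ _ _ Az Ax)[_ /(congr1 odd)].
    by rewrite /= !odd_double.
- by move=> x [].
- exists (fun x n => f (x, n.*2)), q; split=> [x n Ax|||] //.
  + by split; [apply: fA|have [] := qD x n Ax].
  + by move=> x y n m Ax Ay /(fi _ _ _ _ Ax Ay)[-> /double_inj].
  + move=> x y n m Ax Ay E; have [_ []] := qD y m Ay.
    by exists x => //; exists n.
Qed.

Lemma card_le1P T (A : set T) :
  A #<= `I_1 <-> forall x y, A x -> A y -> x = y.
Proof.
split=> [/card_le_fun/(_ 0%N)[f fA fi] x y Ax Ay|A1].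
  have f0 z : A z -> f z = 0%N by move=> Az; have := fA z Az; case: (f z).
  by apply: fi => //; rewrite !f0.
apply: (card_le_rel (R := fun _ n => n = 0%N)) => [x _|x y _ Ax Ay _ _].
  by exists 0%N.
exact: A1.
Qed.

Lemma card_ge2P T (A : set T) :
  `I_2 #<= A <-> exists x y, [/\ A x, A y & x <> y].
Proof.
split=> [A2|[x [y [Ax Ay xy]]]].
  have : ~ (A #<= `I_1) by move=> /(card_le_trans A2); rewrite card_le_II.
  move=> /card_le1P/existsNP[x /existsNP[y]].
  by move=> /not_implyP[Ax /not_implyP[Ay xy]]; exists x, y.
apply: (card_le_rel (R := fun n z => n = 0%N /\ z = x \/ n = 1%N /\ z = y)).
  by move=> [|[|//]] _; [exists x => //; left|exists y => //; right].
by move=> n m z _ _ [[-> ->]|[-> ->]] [[-> //]|[-> //]]; move=> E; case: xy.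
Qed.

(** * Paths in product graphs *)

Section Products.
Context {X : Type}.
Implicit Types (a b c : pbrauer X) (u v w : X + X) (x y z : X).

Definition isolated a u : Prop := forall v, ~ a u v.

(** Brauer graphs are matchings, so an inclusion can be proper only at vertices
    that are isolated in the smaller graph. *)
Lemma eq_of_sub_isolated a b :
  (forall u v, a u v -> b u v) -> (forall u, isolated a u -> isolated b u) ->
  a = b.
Proof.
move=> ab iab; apply: pb_ext => u v; split=> [/ab//|buv].
have [[w auw]|nau] := pselect (exists w, a u w).
  by rewrite (pb_deg buv (ab _ _ auw)).
by case: (iab u _ v) => // w auw; apply: nau; exists w.
Qed.

Lemma connected_closed T (e : T -> T -> Prop) (S : T -> Prop) p q :
  (forall s t, S s -> e s t -> S t) -> connected e p q -> S p -> S q.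
Proof. by move=> Se; elim=> [s t st /Se|//|s t r _ IH1 _ IH2 /IH1]; auto. Qed.

Lemma product_l a b u v :
  a u v -> connected (product_graph a b) (vee u) (vee v).
Proof. by move=> auv; apply: rt_step; left; exists u, v. Qed.

Lemma product_r a b u v :
  b u v -> connected (product_graph a b) (wedge u) (wedge v).
Proof. by move=> buv; apply: rt_step; right; exists u, v. Qed.

Lemma neq_edge a u v : a u v -> u <> v.
Proof. by move=> auv uv; subst v; apply: pb_irr auv. Qed.

Lemma mul_upper a b x y : a (inl x) (inl y) -> (a * b)%g (inl x) (inl y).
Proof.
by move=> axy; split; [exact: neq_edge axy|exact: (product_l b axy)].
Qed.

Lemma mul_transversal a b x y z :
  transversal a x y -> transversal b y z -> transversal (a * b)%g x z.
Proof.
move=> /(product_l b) xy /(product_r a) yz; split=> //.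
exact: rt_trans xy yz.
Qed.

Lemma mul_transversal_upper a b x y z (w : X) :
  transversal a x y -> b (inl y) (inl z) -> transversal a w z ->
  (a * b)%g (inl x) (inl w).
Proof.
move=> axy byz awz; split.
  move=> [xw]; subst w; have [yz] := pb_deg axy awz.
  by subst z; apply: pb_irr byz.
apply: rt_trans (product_l b axy) _; apply: rt_trans (product_r a byz) _.
exact: product_l (pb_sym awz).
Qed.

Lemma mul_isolated a b x : isolated a (inl x) -> isolated (a * b)%g (inl x).
Proof.
move=> ix v [xv]; move=> /(connected_closed (S := fun p => p = Up x)) H.
have : outer v = Up x.
  apply: H => // s t -> [] [[y|y] [w [e //= E _]]]; case: E e => -> /ix //.
by case: v xv {H} => y //= xy [yx]; apply: xy; rewrite yx.
Qed.

Lemma mul_transversal_isolated a b x y :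
  transversal a x y -> isolated b (inl y) -> isolated (a * b)%g (inl x).
Proof.
move=> axy iy v [xv].
move=> /(connected_closed (S := fun p => p = Up x \/ p = Mid y)) H.
have : outer v = Up x \/ outer v = Mid y.
  apply: H; last by left.
  move=> s t [->|->] [] [[z|z] [w [e //= [E] <-]]]; subst z.
  - by right; rewrite (pb_deg e axy).
  - by left; rewrite (pb_deg e (pb_sym axy)).
  - by case: (iy w).
by case: v xv {H} => z xz [] // [zx]; apply: xz; rewrite zx.
Qed.

Lemma Dom_mul a b : Dom (a * b)%g `<=` Dom a.
Proof.
move=> x [y abxy].
have [[[w|w] axw]|nax] := pselect (exists u, a (inl x) u).
- by have := pb_deg abxy (mul_upper b axw).
- by exists w.
- by case: (@mul_isolated a b x _ _ abxy) => u axu; apply: nax; exists u.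
Qed.

Definition swap (u : X + X) : X + X :=
  match u with inl x => inr x | inr x => inl x end.

Lemma swapK : involutive swap. Proof. by case. Qed.

(** The reflection exchanging X and X', an anti-automorphism of the monoid. Both
    arguments are exchanged so that [transversal (flip a) x y] is
    [transversal a y x] by computation. *)
Definition flip a : pbrauer X.
Proof.
refine (@PBrauer X (fun u v => a (swap v) (swap u)) _ _ _).
- by move=> u v; apply: pb_sym.
- by move=> u; apply: pb_irr.
- move=> u v w /pb_sym uv /pb_sym uw.
  exact: (can_inj swapK) (pb_deg uv uw).
Defined.

Lemma flipK : involutive flip.
Proof.
by move=> a; apply: pb_ext => u v; rewrite /= !swapK.
Qed.

Lemma flip_mul a b : flip (a * b)%g = flip b * flip a.
Proof.
pose r (p : vertex3 X) :=
  match p with Up x => Low x | Mid x => Mid x | Low x => Up x end.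
have rK : involutive r by case.
have rout u : r (outer u) = outer (swap u) by case: u.
have step c (d : pbrauer X) p q : connected (product_graph c d) p q ->
    connected (product_graph (flip d) (flip c)) (r q) (r p).
  move=> pq; apply: connected_sym; first exact: product_graph_sym.
  move: pq; apply: connected_sub => s t [] [u [v [e <- <-]]].
    have -> : r (vee u) = wedge (swap u) by case: (u).
    have -> : r (vee v) = wedge (swap v) by case: (v).
    by apply: product_r => /=; rewrite !swapK; apply: pb_sym.
  have -> : r (wedge u) = vee (swap u) by case: (u).
  have -> : r (wedge v) = vee (swap v) by case: (v).
  by apply: product_l => /=; rewrite !swapK; apply: pb_sym.
apply: pb_ext => u v; split=> -[nuv uv]; split.
- by move=> uv'; apply: nuv; rewrite uv'.
- by move/step: uv; rewrite !rout !swapK.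
- by move/(can_inj swapK) => uv'; apply: nuv.
- by move/step: uv; rewrite !flipK !rout.
Qed.

Lemma isolated_flip a u : isolated a (swap u) -> isolated (flip a) u.
Proof. by move=> iu v /pb_sym /iu. Qed.

Lemma def_flip a : def (flip a) = codef a. Proof. by []. Qed.

Lemma codef_flip a : codef (flip a) = def a. Proof. by []. Qed.

Lemma supp_flip a : supp (flip a) = supp a.
Proof. by apply/seteqP; split=> x nx /FixE ax; apply: nx; apply/FixE. Qed.

Lemma mul_lower a b x y : b (inr x) (inr y) -> (a * b)%g (inr x) (inr y).
Proof.
move=> bxy; have : (flip b * flip a)%g (inl y) (inl x) by apply: mul_upper.
by rewrite -flip_mul.
Qed.

Lemma mul_isolated_lower a b x :
  isolated b (inr x) -> isolated (a * b)%g (inr x).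
Proof.
move=> ix; rewrite -[a * b]flipK flip_mul.
by apply: isolated_flip; apply: mul_isolated; apply: isolated_flip.
Qed.

End Products.

(** * The invariant of products of idempotents *)

Section Invariant.
Context {X : Type}.
Implicit Types (a b : pbrauer X) (x y z : X).

Lemma codefP a x z : a (inr x) (inr z) -> codef a x.
Proof. by move=> axz [w /pb_sym axw]; have := pb_deg axz axw. Qed.

Lemma defP a x z : a (inl x) (inl z) -> def a x.
Proof. by move=> axz [w axw]; have := pb_deg axz axw. Qed.

Lemma def_mul a b : def a `<=` def (a * b)%g.
Proof. by move=> x nax abx; apply: nax; apply: Dom_mul abx. Qed.

Lemma codef_mul a b : codef b `<=` codef (a * b)%g.
Proof.
by rewrite -def_flip -[codef (a * b)%g]def_flip flip_mul; apply: def_mul.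
Qed.

Lemma suppE a : supp a = def a `|` sh a.
Proof.
apply/seteqP; split=> [x nfx|x [nax [ax _]|[]//]].
  by have [ax|nax] := pselect (Dom a x); [right|left].
by apply: nax.
Qed.

Lemma supp_mul a b : supp (a * b)%g `<=` supp a `|` supp b.
Proof.
move=> x nx; apply: contrapT => /not_orP[/contrapT/FixE ax /contrapT/FixE bx].
by apply: nx; apply/FixE; apply: mul_transversal ax bx.
Qed.

(** If y were in the domain of a, then a * a would map x further than y; if y
    were isolated, then x would be isolated in a * a. *)
Lemma idempotent_moved a x y : a * a = a -> transversal a x y -> x <> y ->
  exists z, a (inl y) (inl z).
Proof.
move=> aa axy xy.
have [[[z|z] ayz]|nay] := pselect (exists u, a (inl y) u).
- by exists z.
- have := mul_transversal axy ayz; rewrite aa => axz.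
  have [yz] := pb_deg axy axz; subst z.
  by have [] := pb_deg (pb_sym axy) (pb_sym ayz).
- have iy : isolated a (inl y) by move=> u ayu; apply: nay; exists u.
  by have := mul_transversal_isolated axy iy; rewrite aa => /(_ _ axy).
Qed.

Lemma idempotent_sh_le a : a * a = a -> sh a #<= def a.
Proof.
move=> aa; apply: (card_le_rel (R := transversal a)).
  move=> x [[y axy] nfx]; exists y => //.
  have xy : x <> y by move=> xy; subst y; apply: nfx; apply/FixE.
  by have [z /defP] := idempotent_moved aa axy xy.
by move=> x x' y _ _ /pb_sym yx /pb_sym yx'; have [] := pb_deg yx yx'.
Qed.

Lemma idempotent_supp_le a : a * a = a -> infinite_set (supp a) ->
  supp a #<= def a.
Proof.
move=> aa; rewrite suppE => ainf; apply: card_le_setU => //; last first.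
  exact: idempotent_sh_le.
move=> dfin; apply: ainf; rewrite finite_setU; split=> //.
by apply: card_le_finite dfin; apply: idempotent_sh_le.
Qed.

(** For infinite support: defect and codefect are both as large as the support,
    which contains them. *)
Definition balanced a : Prop :=
  infinite_set (supp a) -> supp a #<= def a /\ supp a #<= codef a.

Definition good a : Prop :=
  (finite_set (supp a) -> def a #<= `I_1 -> sh a = set0) /\ balanced a.

Lemma idempotent_flip a : a * a = a -> flip a * flip a = flip a.
Proof. by move=> aa; rewrite -flip_mul aa. Qed.

Lemma idempotent_good a : a * a = a -> good a.
Proof.
move=> aa; split=> [_ /card_le1P d1|ainf].
  apply/seteqP; split=> // x [[y axy] nfx].
  have xy : x <> y by move=> xy; subst y; apply: nfx; apply/FixE.
  have [z ayz] := idempotent_moved aa axy xy.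
  have yz := d1 _ _ (defP ayz) (defP (pb_sym ayz)); subst z.
  exact: pb_irr ayz.
split; first exact: idempotent_supp_le.
rewrite -supp_flip -def_flip; apply: idempotent_supp_le.
  exact: idempotent_flip.
by rewrite supp_flip.
Qed.

(** At a fixed point x of a, the path in the product graph copies what b does at
    x, unless b has a hook whose other end is moved or lost by a. *)
Lemma def_mul_sub a b : def b `<=` def (a * b)%g `|`
  (supp a `|` [set x | exists2 z, supp a z & b (inl x) (inl z)]).
Proof.
move=> x nbx; apply: contrapT => /not_orP[/contrapT[y abxy]].
move=> /not_orP[/contrapT/FixE ax nz].
have [[[z|z] bxz]|nbx'] := pselect (exists u, b (inl x) u).
- have [/FixE az|nfz] := pselect (Fix a z); last by apply: nz; exists z.
  by have := pb_deg abxy (mul_transversal_upper ax bxz az).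
- by apply: nbx; exists z.
- apply: (mul_transversal_isolated ax _ abxy) => u bxu.
  by apply: nbx'; exists u.
Qed.

(** By [def_mul_sub], the defect of b, of the size of supp b, is covered by the
    defect of a * b and two sets no larger than supp a. So either the defect of
    a * b is large enough, or supp a is, and then the defect of a does it. *)
Lemma balanced_mul_le a b : balanced a -> balanced b -> infinite_set (supp b) ->
  supp a #<= supp b ->
  supp (a * b)%g #<= def (a * b)%g /\ supp (a * b)%g #<= codef (a * b)%g.
Proof.
move=> ga gb binf ab.
have [bd bc] := gb binf.
have abb : supp (a * b)%g #<= supp b.
  apply: card_le_trans (subset_card_le (@supp_mul a b)) _.
  exact: card_le_setU.
suff bd' : supp b #<= def (a * b)%g.
  split; first exact: card_le_trans abb bd'.
  apply: card_le_trans abb (card_le_trans bc _).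
  exact/subset_card_le/codef_mul.
have hooks : [set x | exists2 z, supp a z & b (inl x) (inl z)] #<= supp a.
  apply: (card_le_rel (R := fun x z => b (inl x) (inl z))).
    by move=> x [z az bxz]; exists z.
  by move=> x y z _ _ /pb_sym zx /pb_sym zy; have [] := pb_deg zx zy.
have [//|{}bd] := infinite_card_leU binf
  (card_le_trans bd (subset_card_le (@def_mul_sub a b))).
have ba : supp b #<= supp a.
  by have [//|/card_le_trans] := infinite_card_leU binf bd; apply.
have ainf : infinite_set (supp a) by move=> /(card_le_finite ba).
apply: card_le_trans ba (card_le_trans (ga ainf).1 _).
exact/subset_card_le/def_mul.
Qed.

(** A vertex x' that is not on a transversal comes from an undefined x, because
    a maps each point of its domain to itself; so at most one vertex on each
    side is free, and no hook is possible. *)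
Lemma sub_one a : def a #<= `I_1 -> sh a = set0 ->
  forall u v, a u v -> pb_one_edge u v.
Proof.
move=> /card_le1P d1 sh0.
have fix_ x : Dom a x -> transversal a x x.
  move=> ax; apply/FixE; apply: contrapT => nfx.
  by have : sh a x by []; rewrite sh0.
have tr x y : transversal a x y -> x = y.
  move=> axy; have axx : transversal a x x by apply: fix_; exists y.
  by have [] := pb_deg axx axy.
move=> [x|x] [y|y] axy.
- have xy := d1 _ _ (defP axy) (defP (pb_sym axy)); subst y.
  by have := pb_irr axy.
- by rewrite (tr _ _ axy); exists y; left.
- by rewrite (tr _ _ (pb_sym axy)); exists x; right.
- have cd z w : a (inr z) (inr w) -> def a z.
    by move=> azw /fix_ azz; apply: codefP azw _; exists z.
  have xy := d1 _ _ (cd _ _ axy) (cd _ _ (pb_sym axy)); subst y.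
  by have := pb_irr axy.
Qed.

(** Collapsing the layers X and X'' turns the edges of a into loops. *)
Lemma sub_one_mul a b : (forall u v, a u v -> pb_one_edge u v) ->
  forall u v, (a * b)%g u v -> b u v.
Proof.
move=> a1 u v [nuv uv].
pose r (p : vertex3 X) :=
  match p with Up x | Mid x => inl x | Low x => inr x end.
have rK w : r (outer w) = w by case: w.
have : connected b (r (outer u)) (r (outer v)).
  apply: connected_sub uv => _ _ [[s [t [st <- <-]]]|[s [t [st <- <-]]]].
    by case: (a1 _ _ st) => x [[-> ->]|[-> ->]] /=; apply: rt_refl.
  by apply: rt_step; case: s t st => [s|s] [t|t].
by rewrite !rK => /(connected_deg (@pb_sym _ b) (@pb_deg _ b))[/nuv|].
Qed.

(** A factor below a product of defect at most 1 has itself defect at most 1: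
    clear for a; and once a is a partial identity, a * b is contained in b. *)
Lemma good_mul_finite a b : good a -> good b ->
  finite_set (supp a) -> finite_set (supp b) ->
  def (a * b)%g #<= `I_1 -> sh (a * b)%g = set0.
Proof.
move=> [ga _] [gb _] afin bfin ab1.
have a1 : def a #<= `I_1.
  by apply: card_le_trans ab1; apply/subset_card_le/def_mul.
have ab_b := sub_one_mul (b := b) (sub_one a1 (ga afin a1)).
have b1 : def b #<= `I_1.
  apply: card_le_trans ab1; apply: subset_card_le => x nbx [y abxy].
  by apply: nbx; exists y; apply: ab_b.
have b_1 := sub_one b1 (gb bfin b1).
apply/seteqP; split=> // x [[y abxy] nfx]; apply: nfx; apply/FixE.
case: (b_1 _ _ (ab_b _ _ abxy)) => z [[[xz] [yz]]|[]//].
by subst x y.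
Qed.

Lemma balanced_flip a : balanced a -> balanced (flip a).
Proof.
by rewrite /balanced supp_flip def_flip codef_flip => ga /ga[].
Qed.

Lemma supp_def a : def a `<=` supp a.
Proof. by rewrite suppE; left. Qed.

Lemma supp_codef a : codef a `<=` supp a.
Proof. by rewrite -def_flip -supp_flip; apply: supp_def. Qed.

Lemma balanced_mul a b : balanced a -> balanced b -> balanced (a * b).
Proof.
move=> ga gb abinf.
have uinf : infinite_set (supp a `|` supp b).
  by move=> fin; apply: abinf; apply: sub_finite_set fin; apply: supp_mul.
have [ab|ba] := card_le_total (supp a) (supp b).
  apply: balanced_mul_le => // bfin; apply: uinf; rewrite finite_setU.
  by split=> //; apply: card_le_finite bfin.
have ainf : infinite_set (supp a).
  move=> afin; apply: uinf; rewrite finite_setU.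
  by split=> //; apply: card_le_finite afin.
have [] := balanced_mul_le (balanced_flip gb) (balanced_flip ga).
- by rewrite supp_flip.
- by rewrite !supp_flip.
- by rewrite -flip_mul supp_flip def_flip codef_flip.
Qed.

Lemma good_mul a b : good a -> good b -> good (a * b).
Proof.
move=> [fa ba] [fb bb]; split; last exact: balanced_mul.
move=> abfin; apply: good_mul_finite => //; apply: contrapT.
- move=> /[dup] ainf /ba[/card_le_finite ad _]; apply/ainf/ad.
  by apply: sub_finite_set abfin => x /(@def_mul a b) /supp_def.
- move=> /[dup] binf /bb[_ /card_le_finite bc]; apply/binf/bc.
  by apply: sub_finite_set abfin => x /(@codef_mul a b) /supp_codef.
Qed.

Lemma goodP a : good a <->
  ([set a | def a #<= `I_1 /\ sh a = set0]
    `|` [set a | `I_2 #<= def a /\ finite_set (supp a)]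
    `|` [set a | [/\ def a #= codef a, [set: nat] #<= def a
                   & sh a #<= def a]]) a.
Proof.
split=> [[fa ba]|[[[d1 sh0]|[d2 afin]]|[dc dinf sd]]].
- have [afin|/[dup] ainf /ba[sd sc]] := pselect (finite_set (supp a)).
    left; have [d1|nd1] := pselect (def a #<= `I_1); [left|right].
      by split=> //; apply: fa.
    split=> //; have [//|d2] := card_le_total `I_2 (def a).
    apply/card_ge2P; apply: contrapT => nd2; apply: nd1.
    apply/card_le1P => x y ax ay.
    by apply: contrapT => xy; apply: nd2; exists x, y.
  right; split.
  + apply/card_eqPle; split.
      exact: card_le_trans (subset_card_le (@supp_def a)) sc.
    exact: card_le_trans (subset_card_le (@supp_codef a)) sd.
  + by apply/infiniteP => dfin; apply: ainf; apply: card_le_finite dfin.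
  + by apply: card_le_trans sd; apply: subset_card_le; rewrite suppE; right.
- split=> // ainf; exfalso; apply: ainf; rewrite suppE sh0 setU0.
  by apply/finite_set_leP; exists 1%N.
- split=> // _ /(card_le_trans d2); by rewrite card_le_II.
- move/infiniteP: dinf => dinf.
  have sud : supp a #<= def a by rewrite suppE; apply: card_le_setU.
  split=> [/(sub_finite_set (@supp_def a))//|_].
  by split=> //; apply: card_le_trans sud _; move/card_eqPle: dc => [].
Qed.
End Invariant.

(** * Sliding idempotents *)

Section Slide.
Context {X I : Type} (s t z : I -> X).
Hypotheses (s_inj : injective s) (t_inj : injective t) (z_inj : injective z).
Hypotheses (st : forall i j, s i <> t j) (sz : forall i j, s i <> z j)
  (tz : forall i j, t i <> z j).

Definition resting x : Prop := forall i, [/\ x <> s i, x <> t i & x <> z i].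

(** Tokens move from the s i to the free places t i; the hooks at the z i are
    there to make the graph idempotent. Each edge is listed in one
    orientation. *)
Definition slide_half (u v : X + X) : Prop :=
  [\/ exists i, u = inl (s i) /\ v = inr (t i),
      exists i, u = inl (t i) /\ v = inl (z i),
      exists i, u = inr (s i) /\ v = inr (z i) |
      exists2 x, resting x & u = inl x /\ v = inr x].

Definition slide_edge u v : Prop := slide_half u v \/ slide_half v u.

Lemma slide_sym u v : slide_edge u v -> slide_edge v u.
Proof. by case; [right|left]. Qed.

Lemma slide_irr u : ~ slide_edge u u.
Proof.
suff H : ~ slide_half u u by case.
case=> [[i [-> //]]|[i [->] []]|[i [->] []]|[x _ [-> //]]].
  exact: tz.
exact: sz.
Qed.

Lemma slide_deg u v w : slide_edge u v -> slide_edge u w -> v = w.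
Proof.
have rest x i : resting x -> [/\ s i <> x, t i <> x & z i <> x].
  by move=> /(_ i)[xs xt xz]; split; apply/nesym.
(* Two clauses that meet at u give an equation E between points of X; either E
   is impossible, or the two clauses and their indices agree. *)
by case=> -[[i [-> ->]]|[i [-> ->]]|[i [-> ->]]|[x /rest rx [-> ->]]];
  case=> -[[j []]|[j []]|[j []]|[y /rest ry []]] //;
  first [move=> -> [] | move=> [] + -> | move=> []] => E //;
  try (by case: (st E)); try (by case: (st (esym E)));
  try (by case: (sz E)); try (by case: (sz (esym E)));
  try (by case: (tz E)); try (by case: (tz (esym E)));
  try (by case: (rx j) => *; exfalso; auto);
  try (by case: (ry i) => *; exfalso; auto);
  rewrite ?(s_inj E) ?(t_inj E) ?(z_inj E) ?E.
Qed.

Definition slide : pbrauer X := PBrauer slide_sym slide_irr slide_deg.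

Lemma slide_move i : transversal slide (s i) (t i).
Proof. by left; constructor 1; exists i. Qed.

Lemma slide_rest x : resting x -> transversal slide x x.
Proof. by left; constructor 4; exists x. Qed.

Lemma slide_cup i : slide (inl (t i)) (inl (z i)).
Proof. by left; constructor 2; exists i. Qed.

Lemma slide_cap i : slide (inr (s i)) (inr (z i)).
Proof. by left; constructor 3; exists i. Qed.

Lemma slide_nisolated u : exists v, slide u v.
Proof.
have [rx|] := pselect (resting (match u with inl x | inr x => x end)).
  case: u rx => x rx; [exists (inr x)|exists (inl x)]; first exact: slide_rest.
  exact: slide_sym (slide_rest rx).
move=> /existsNP[i ri].
have {ri} : [\/ match u with inl x | inr x => x end = s i,
   match u with inl x | inr x => x end = t i |
   match u with inl x | inr x => x end = z i].
  apply: contrapT => n; apply: ri; split=> E; apply: n.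
  - by constructor 1.
  - by constructor 2.
  - by constructor 3.
case: u => x [->|->|->].
- by exists (inr (t i)); apply: slide_move.
- by exists (inl (z i)); apply: slide_cup.
- by exists (inl (t i)); apply: slide_sym; apply: slide_cup.
- by exists (inr (z i)); apply: slide_cap.
- by exists (inl (s i)); apply: slide_sym; apply: slide_move.
- by exists (inr (s i)); apply: slide_sym; apply: slide_cap.
Qed.

(** In the product graph the path from s i runs through t i'', z i'' and s i''
    before it leaves at t i'. *)
Lemma slide_idempotent : slide * slide = slide.
Proof.
apply/esym/eq_of_sub_isolated => [u v|u iu]; last first.
  by have [v /iu] := slide_nisolated u.
suff H u' v' : slide_half u' v' -> (slide * slide)%g u' v'.
  by case=> /H //; apply: pb_sym.
case=> [[i [-> ->]]|[i [-> ->]]|[i [-> ->]]|[x rx [-> ->]]].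
- split=> //.
  have h1 := product_l slide (slide_move i).
  have h2 := product_r slide (slide_cup i).
  have h3 := product_l slide (pb_sym (slide_cap i)).
  have h4 := product_r slide (slide_move i).
  refine (rt_trans _ _ _ _ _ h1 (rt_trans _ _ _ _ _ h2 _)).
  exact: rt_trans h3 h4.
- exact/mul_upper/slide_cup.
- exact/mul_lower/slide_cap.
- by apply: mul_transversal; apply: slide_rest.
Qed.
End Slide.

(** * Realizing partial bijections *)

Section Generation.
Context {X : Type}.
Implicit Types (a b : pbrauer X) (x y z : X) (R S : X -> X -> Prop).

Lemma E_idempotent a : a * a = a -> E_ X a.
Proof. by move=> aa S [_ /(_ a aa)]. Qed.

Lemma E_mul a b : E_ X a -> E_ X b -> E_ X (a * b).
Proof.
move=> Ea Eb S cS; apply: set_mem; apply: cS.1; apply: mem_set.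
  exact: Ea.
exact: Eb.
Qed.

(** The left factor of [sandwich]. It has the upper hooks of a and fixes Dom a
    pointwise, which makes it idempotent. *)
Definition upper_edge a (u v : X + X) : Prop :=
  match u, v with
  | inl x, inl y => a (inl x) (inl y)
  | inl x, inr y | inr x, inl y => x = y /\ Dom a x
  | inr _, inr _ => False
  end.

Lemma upper_sym a u v : upper_edge a u v -> upper_edge a v u.
Proof. by case: u v => x [] y //=; [apply: pb_sym|case=> ->|case=> ->]. Qed.

Lemma upper_irr a u : ~ upper_edge a u u.
Proof. by case: u => x //=; apply: pb_irr. Qed.

Lemma upper_deg a u v w : upper_edge a u v -> upper_edge a u w -> v = w.
Proof.
case: u v w => x [] y [] z //=.
- exact: pb_deg.
- by move=> axy [_ ax]; case: (defP axy ax).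
- by move=> [_ ax] axy; case: (defP axy ax).
- by move=> [-> _] [-> _].
- by move=> [-> _] [-> _].
Qed.

Definition upper_part a : pbrauer X :=
  PBrauer (@upper_sym a) (@upper_irr a) (@upper_deg a).

Lemma upper_part_idempotent a : upper_part a * upper_part a = upper_part a.
Proof.
have fixed x : Dom a x -> transversal (upper_part a) x x by [].
apply/esym/eq_of_sub_isolated => [[x|x] [y|y]|[x|x]] //.
- exact: mul_upper.
- by move=> [<- ax]; apply: mul_transversal (fixed _ ax) (fixed _ ax).
- by move=> [<- ax]; apply: pb_sym (mul_transversal (fixed _ ax) (fixed _ ax)).
- exact: mul_isolated.
- exact: mul_isolated_lower.
Qed.

(** The outer factors decide the hooks and the isolated vertices of the product,
    so only the transversals of g on Dom a matter. *)
Lemma sandwich a g : (forall x y, transversal a x y -> transversal g x y) ->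
  a = upper_part a * g * flip (upper_part (flip a)).
Proof.
move=> ag; set e := upper_part a; set f := flip _.
have tr x y : transversal a x y -> transversal (e * g * f) x y.
  move=> axy; apply: (@mul_transversal _ _ _ _ y).
    by apply: (@mul_transversal _ _ _ _ x); [split=> //; exists y|exact: ag].
  by split=> //; exists x.
apply: eq_of_sub_isolated => [[x|x] [y|y] axy|[x|x] ix].
- by do 2!apply: mul_upper.
- exact: tr.
- exact: pb_sym (tr _ _ (pb_sym axy)).
- by apply: mul_lower.
- do 2!apply: mul_isolated; move=> [y axy|y [_ [z axz]]].
    exact: (ix _ axy).
  exact: (ix _ axz).
- apply: mul_isolated_lower => -[y [yx [z azx]]|y axy].
    by subst y; apply: (ix _ (pb_sym azx)).
  exact: (ix _ axy).
Qed.

(** An inclusion is what [sandwich] asks for, and unlike an equality it passes to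
    composites whatever the hooks of the factors are. *)
Definition realizable R : Prop :=
  exists2 g, E_ X g & forall x y, R x y -> transversal g x y.

Lemma E_of_realizable a : realizable (transversal a) -> E_ X a.
Proof.
move=> [g Eg ag]; rewrite (sandwich ag); apply: E_mul.
  by apply: E_mul => //; exact: E_idempotent (upper_part_idempotent a).
exact: E_idempotent (idempotent_flip (upper_part_idempotent _)).
Qed.

Lemma realizable_sub R S :
  (forall x y, R x y -> S x y) -> realizable S -> realizable R.
Proof. by move=> RS [g Eg gS]; exists g => // x y /RS; apply: gS. Qed.

Lemma realizable_comp R S : realizable R -> realizable S ->
  realizable (fun x z => exists2 y, R x y & S y z).
Proof.
move=> [g Eg gR] [h Eh hS]; exists (g * h); first exact: E_mul.
by move=> x z [y /gR xy /hS yz]; apply: mul_transversal xy yz.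
Qed.

Lemma realizable_id : realizable eq.
Proof.
exists (1 : pbrauer X); first by apply: E_idempotent; apply: mulg1.
by move=> x y <-; exists x; left.
Qed.

Lemma realizable_slide (I : Type) (s t z : I -> X) :
  injective s -> injective t -> injective z ->
  (forall i j, s i <> t j) -> (forall i j, s i <> z j) ->
  (forall i j, t i <> z j) ->
  realizable (fun x y => (exists2 i, x = s i & y = t i) \/
                    (x = y /\ resting s t z x)).
Proof.
move=> si ti zi st sz tz.
exists (slide si ti zi st sz tz).
  exact: E_idempotent (slide_idempotent si ti zi st sz tz).
by move=> x y [[i -> ->]|[<-]]; [exact: slide_move|exact: slide_rest].
Qed.

(** What remains to be done after the token at x has been moved to y. *)
Definition after_move x y R w v : Prop := (w <> x /\ R w v) \/ (w = y /\ R x v).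

Definition undefined_at R x : Prop := forall y, ~ R x y.

Lemma realizable_after x y z R : x <> y -> x <> z -> y <> z ->
  undefined_at R y -> undefined_at R z ->
  realizable (after_move x y R) -> realizable R.
Proof.
move=> xy xz yz Ry Rz rR.
have sl : realizable (fun w v => (exists2 i : unit, w = x & v = y) \/
    (w = v /\ resting (fun _ : unit => x) (fun=> y) (fun=> z) w)).
  by apply: realizable_slide => // -[] [].
apply: realizable_sub (realizable_comp sl rR) => w v Rwv.
have [wx|wx] := pselect (w = x).
  by subst w; exists y; [left; exists tt|right].
exists w; last by left.
right; split=> // _; split=> // E; subst w; [exact: Ry Rwv|exact: Rz Rwv].
Qed.

End Generation.

(** Induction on the size of a list s containing the misplaced tokens; d1 and d2
    are free places. *)
Lemma realizable_finite (X : eqType) (s : seq X) (R : X -> X -> Prop)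
    (d1 d2 : X) :
  (forall x y y', R x y -> R x y' -> y = y') ->
  (forall x x' y, R x y -> R x' y -> x = x') ->
  d1 <> d2 -> undefined_at R d1 -> undefined_at R d2 ->
  (forall x y, R x y -> x <> y -> x \in s) -> realizable R.
Proof.
have [n] := ubnP (size s).
elim: n => // n IH in s R d1 d2 * => sn Rf Ri dd R1 R2 Rs.
have [[x [y [Rxy xy]]]|triv] :=
  pselect (exists x y, R x y /\ x <> y); last first.
  apply: realizable_sub realizable_id => x y Rxy; apply: contrapT => xy.
  by apply: triv; exists x, y.
(* A token whose target y is free is moved there; the helper z is one of the two
   free places other than y, and x becomes free. *)
have place (s' : seq X) S e1 e2 : (size s' <= n)%N ->
    (forall x y y', S x y -> S x y' -> y = y') ->
    (forall x x' y, S x y -> S x' y -> x = x') ->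
    e1 <> e2 -> undefined_at S e1 -> undefined_at S e2 ->
    S x y -> undefined_at S y ->
    (forall x y, S x y -> x <> y -> x \in s') -> realizable S.
  move=> s'n Sf Si ee S1 S2 Sxy Sy Ss.
  have [z yz Sz] : exists2 z, y <> z & undefined_at S z.
    have [ye|ye] := pselect (y = e1); first by exists e2 => //; rewrite ye.
    by exists e1.
  have xz : x <> z by move=> xz; subst z; apply: Sz Sxy.
  apply: (realizable_after xy xz yz Sy Sz).
  have xs' : x \in s' by apply: Ss Sxy xy.
  apply: (IH (rem x s') _ x z) => //.
  - rewrite size_rem //; case: (s') xs' s'n => //=.
  - move=> w v v' [[_ h]|[-> h]] [[_ h']|[E h']]; subst.
    + exact: Sf h h'.
    + by case: (Sy _ h).
    + by case: (Sy _ h').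
    + exact: Sf h h'.
  - move=> w w' v [[wx h]|[-> h]] [[wx' h']|[-> h']] //.
    + exact: Si h h'.
    + by case: wx; apply: Si h h'.
    + by case: wx'; apply: Si h' h.
  - by move=> v [[]|[/xy]].
  - by move=> v [[_ /Sz]|[/esym/yz]].
  - move=> w v [[wx h] wv|[-> h]]; last by rewrite (Sf _ _ _ h Sxy).
    have := Ss _ _ h wv; rewrite (perm_mem (perm_to_rem xs')) inE.
    by case/orP=> [/eqP|].
have [[w Ryw]|Ry] := pselect (exists w, R y w); last first.
  apply: (place s R d1 d2) => // w Ryw; apply: Ry; by exists w.
have yw : y <> w by move=> yw; subst w; apply: xy; apply: Ri Rxy Ryw.
have yd1 : y <> d1 by move=> E; subst d1; apply: R1 Ryw.
have yd2 : y <> d2 by move=> E; subst d2; apply: R2 Ryw.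
have ys : y \in s by apply: Rs Ryw yw.
(* The target y is occupied: its token is first moved to d1, which does
   not increase the number of misplaced tokens and makes y free. *)
apply: (realizable_after yd1 yd2 dd R1 R2).
apply: (place (d1 :: rem y s) _ y d2) => //.
- by rewrite /= size_rem //; case: (s) ys sn.
- move=> u v v' [[_ h]|[-> h]] [[_ h']|[E h']]; subst.
  + exact: Rf h h'.
  + by case: (R1 _ h).
  + by case: (R1 _ h').
  + exact: Rf h h'.
- move=> u u' v [[ux h]|[-> h]] [[ux' h']|[-> h']] //.
  + exact: Ri h h'.
  + by case: ux; apply: Ri h h'.
  + by case: ux'; apply: Ri h' h.
- by move=> v [[]|[/yd1]].
- by move=> v [[_ /R2]|[/esym/dd]].
- by left.
- by move=> v [[]|[/yd1]].
- move=> u v [[uy h] uv|[-> h]]; rewrite inE; last by rewrite eqxx.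
  have := Rs _ _ h uv; rewrite (perm_mem (perm_to_rem ys)) inE.
  by case/orP=> [/eqP //|->]; rewrite orbT.
Qed.

(** * Membership in the idempotent-generated subsemigroup *)

Section Membership.
Context {X : Type}.
Implicit Types (a : pbrauer X).

Lemma transversal_inj a x x' y :
  transversal a x y -> transversal a x' y -> x = x'.
Proof. by move=> /pb_sym h /pb_sym h'; have [] := pb_deg h h'. Qed.

Lemma transversal_fun a x y y' :
  transversal a x y -> transversal a x y' -> y = y'.
Proof. by move=> h h'; have [] := pb_deg h h'. Qed.

Lemma E_of_finite_supp a : `I_2 #<= def a -> finite_set (supp a) -> E_ X a.
Proof.
move=> /card_ge2P[d1 [d2 [n1 n2 dd]]] fin; apply: E_of_realizable.
have [s sE] := (finite_seqP (supp a : set {classic X})).1 fin.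
apply: (@realizable_finite {classic X} s _ d1 d2) => //.
- exact: transversal_fun.
- exact: transversal_inj.
- by move=> y ay; apply: n1; exists y.
- by move=> y ay; apply: n2; exists y.
- move=> x y axy xy.
  have : supp a x.
    by move=> /FixE axx; apply: xy; apply: transversal_fun axx axy.
  by rewrite sE.
Qed.

(** The moved tokens go from sh a into copies P 0 in def a, then Q 0 in codef a,
    then to their targets in Codom a; P 1, P 2 and Q 1 are the helper places. *)
Lemma E_of_infinite_def a : def a #= codef a -> [set: nat] #<= def a ->
  sh a #<= def a -> E_ X a.
Proof.
move=> /card_eqPle[dc _] /infiniteP dinf sd; apply: E_of_realizable.
have [p [q [pq pi qi pqn]]] := disjoint_copies dinf dc.
have [x0 _] := infinite_setN0 dinf.
have [m mD mi] := card_le_fun sd x0.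
have shP (i : sh a) : sh a (val i) by apply: set_mem (valP i).
have md (i : sh a) : def a (m (val i)) by apply: mD.
have mval (i j : sh a) : m (val i) = m (val j) -> i = j.
  by move/(mi _ _ (shP i) (shP j)); apply: val_inj.
pose P k (i : sh a) := p (m (val i)) k; pose Q k (i : sh a) := q (m (val i)) k.
have Pd k i : def a (P k i) by have [] := pq (m (val i)) k (md i).
have Qc k i : codef a (Q k i) by have [] := pq (m (val i)) k (md i).
have Pinj k : injective (P k).
  by move=> i j /(pi _ _ _ _ (md i) (md j))[/mval].
have Qinj k : injective (Q k).
  by move=> i j /(qi _ _ _ _ (md i) (md j))[/mval].
have PP k l i j : k <> l -> P k i <> P l j.
  by move=> kl /(pi _ _ _ _ (md i) (md j))[_ /kl].
have QQ k l i j : k <> l -> Q k i <> Q l j.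
  by move=> kl /(qi _ _ _ _ (md i) (md j))[_ /kl].
have PQ k l i j : P k i <> Q l j by apply: pqn.
have [th thE] : exists th : sh a -> X, forall i : sh a,
    transversal a (val i) (th i).
  have H (i : sh a) : exists y, transversal a (val i) y by have [] := shP i.
  by exists (fun i => sval (cid (H i))) => i; apply: svalP (cid (H i)).
have thinj : injective th.
  move=> i j E; apply: val_inj; apply: transversal_inj (thE i) _.
  by rewrite E; apply: thE.
have vP k (i j : sh a) : val i <> P k j.
  by move=> E; apply: (Pd k j); rewrite -E; exists (th i).
have Qth k i j : Q k i <> th j.
  by move=> E; apply: (Qc k i); rewrite E; exists (val j).
have vinj : injective (fun i : sh a => val i) by exact: val_inj.
have P01 i j : P 0%N i <> P 1%N j by apply: PP.
have P02 i j : P 0%N i <> P 2%N j by apply: PP.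
have Q01 i j : Q 0%N i <> Q 1%N j by apply: QQ.
have QP k l i j : Q k i <> P l j by apply/nesym/PQ.
have thQ k i j : th i <> Q k j by apply/nesym/Qth.
have s1 := realizable_slide vinj (Pinj 0%N) (Pinj 1%N) (vP 0%N) (vP 1%N) P01.
have s2 := realizable_slide (Pinj 0%N) (Qinj 0%N) (Pinj 2%N)
  (PQ 0%N 0%N) P02 (QP 0%N 2%N).
have s3 := realizable_slide (Qinj 0%N) thinj (Qinj 1%N)
  (Qth 0%N) Q01 (thQ 1%N).
apply: realizable_sub (realizable_comp (realizable_comp s1 s2) s3) => x y axy.
have [/FixE axx|nfx] := pselect (Fix a x).
  have yx := transversal_fun axy axx; subst y.
  have xP k i : x <> P k i by move=> E; apply: (Pd k i); rewrite -E; exists x.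
  have xQ k i : x <> Q k i by move=> E; apply: (Qc k i); rewrite -E; exists x.
  have xv (i : sh a) : x <> val i.
    by move=> E; have [_] := shP i; apply; apply/FixE; rewrite -E.
  have xth i : x <> th i.
    move=> E; apply: (xv i); apply: transversal_inj axx _.
    rewrite [X in transversal _ _ X]E.
    exact: thE.
  by exists x; [exists x|]; right.
have shx : sh a x by split=> //; exists y.
pose i : sh a := SigSub (mem_set shx).
exists (Q 0%N i); last first.
  by left; exists i => //; apply: transversal_fun axy (thE i).
by exists (P 0%N i); left; exists i.
Qed.

Lemma E_of_def_le1 a : def a #<= `I_1 -> sh a = set0 -> E_ X a.
Proof.
move=> d1 sh0; have a1 := sub_one d1 sh0; apply: E_idempotent.
apply: pb_ext => u v; split; first exact: sub_one_mul.
move=> auv; have [x [[ux vx]|[ux vx]]] := a1 _ _ auv; subst u v.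
  exact: (mul_transversal (y := x)).
by have axx := pb_sym auv; apply: pb_sym; apply: (mul_transversal (y := x)).
Qed.

Lemma good_of_E a : E_ X a -> good a.
Proof.
apply; split=> [b c /set_mem gb /set_mem gc|b]; last exact: idempotent_good.
by apply: mem_set; apply: good_mul.
Qed.
End Membership.

Unset Implicit Arguments.

Theorem theorem5p8 (X : Type) (X_infinite : infinite_set [set: X]) :
  E_ X =
    [set a : pbrauer X | def a #<= `I_1 /\ sh a = set0]
    `|` [set a : pbrauer X | `I_2 #<= def a /\ finite_set (supp a)]
    `|` [set a : pbrauer X | [/\ def a #= codef a, [set: nat] #<= def a
                               & sh a #<= def a]].
Proof.
apply/seteqP; split=> a; first by move/good_of_E/goodP.
move=> [[[]|[]]|[]].
- exact: E_of_def_le1.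
- exact: E_of_finite_supp.
- exact: E_of_infinite_def.
Qed.
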